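(* Let $k$ be a non-negative integer and let $G$ be an edge-colored graph on $n$ vertices with $n\geq 3k$. If $m(G)+c(G)\geq\binom{n+1}{2}+k-1$ and $G$ contains exactly $k$ rainbow triangles, then $G\in\mathcal{G}_k$.
   Context: Graphs are finite, simple, undirected and have at least one vertex. An edge-colored graph is a graph together with an arbitrary (not necessarily proper) assignment of a color to each edge. $m(G)$ denotes the number of edges of $G$, and $c(G)$ denotes the number of distinct colors that actually appear on the edges of $G$. A subgraph is rainbow if all its edges have pairwise distinct colors; rainbow triangles are counted as distinct subgraphs (by their vertex sets). The classes $\mathcal{G}_k$ ($k\ge 0$ an integer) are defined recursively (simultaneously for all $k$, by recursion on the number of vertices): an edge-colored graph $G$ on $n$ vertices belongs to $\mathcal{G}_k$ if and only if $G$ is a complete graph, $G$ contains exactly $k$ rainbow triangles, $c(G)=n+k-1$, and one of the following holds: (a) $G$ is a single vertex; (b) $G$ is a rainbow triangle; (c) there is a partition $(V_1,V_2)$ of the vertex set of $G$ into two non-empty sets such that all edges of $G$ between $V_1$ and $V_2$ have the same color, $G[V_1]\in\mathcal{G}_i$ and $G[V_2]\in\mathcal{G}_j$ for some non-negative integers $i,j$ with $i+j=k$. Here $G[V_i]$ is the induced subgraph with the inherited edge coloring. *)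

(* Defs.v *)
From mathcomp Require Import all_boot.
Set Implicit Arguments.
Unset Strict Implicit.
Unset Printing Implicit Defensive.

(* A finite simple edge-colored graph whose vertices lie in an ambient finite
   type T, so that induced subgraphs are again graphs over T. An edge is the
   2-set of its endpoints. The values of [color] outside [edges] are junk and
   are never used. The vertex set may be empty here; non-emptiness is a
   separate hypothesis wherever it matters. *)
Record ecgraph (T : finType) (C : eqType) := ECGraph {
  vset : {set T};
  edges : {set {set T}};
  color : {set T} -> C;
  edgesP : forall f, f \in edges -> (f \subset vset) && (#|f| == 2)
}.

Section EdgeColoredGraphs.

Variables (T : finType) (C : eqType).
Implicit Types (G : ecgraph T C) (W t : {set T}) (F : {set {set T}}).

Definition gorder G : nat := #|vset G|.

Definition nedges G : nat := #|edges G|.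

Definition ncolors G : nat := size (undup [seq color G f | f <- enum (edges G)]).

Definition complete G : Prop :=
  forall x y, x \in vset G -> y \in vset G -> x != y -> [set x; y] \in edges G.

Definition rainbow G F : bool := dinjectiveb (color G) F.

Definition pairs t : {set {set T}} := [set f : {set T} | f \subset t & #|f| == 2].

(* A triangle is identified with its vertex set t; its edges are [pairs t]. *)
Definition rainbow_triangle G t : bool :=
  [&& #|t| == 3, pairs t \subset edges G & rainbow G (pairs t)].

Definition rainbow_triangles G : {set {set T}} := [set t | rainbow_triangle G t].

Fact induced_edgesP G W f :
  f \in [set f in edges G | f \subset W] ->
  (f \subset vset G :&: W) && (#|f| == 2).
Proof.
by rewrite inE subsetI => /andP[/edgesP/andP[-> ->] ->].
Qed.

Definition induced G W : ecgraph T C :=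
  ECGraph (color G) (@induced_edgesP G W).

Definition bipartition G (V1 V2 : {set T}) : Prop :=
  [/\ V1 != set0, V2 != set0, [disjoint V1 & V2] & V1 :|: V2 = vset G].

Definition monochromatic_between G (V1 V2 : {set T}) : Prop :=
  exists a : C, forall x y, x \in V1 -> y \in V2 ->
    [set x; y] \in edges G -> color G [set x; y] = a.

(* The conditions common to all three clauses of the definition of G_k. The
   subtraction is never truncated in [Gclass], whose members are non-empty. *)
Definition Gclass_common (k : nat) G : Prop :=
  [/\ complete G, #|rainbow_triangles G| = k & ncolors G = gorder G + k - 1].

Inductive Gclass : nat -> ecgraph T C -> Prop :=
| Gclass_vertex k G :
    Gclass_common k G -> gorder G = 1 -> Gclass k G
| Gclass_triangle k G :
    Gclass_common k G -> rainbow_triangle G (vset G) -> Gclass k G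
| Gclass_split k G (V1 V2 : {set T}) (i j : nat) :
    Gclass_common k G ->
    bipartition G V1 V2 -> monochromatic_between G V1 V2 ->
    Gclass i (induced G V1) -> Gclass j (induced G V2) -> i + j = k ->
    Gclass k G.

End EdgeColoredGraphs.

(* Main.v *)
Require Import Defs.
From mathcomp Require Import all_boot zify.
(* Deleting a vertex v with the most missing edges, say d, and lying in t rainbow
   triangles loses s colours, those seen only at v. Any two ends of edges at v
   representing these s colours are non-adjacent or span a rainbow triangle with
   v, so s(s - 1) <= s d + 2 t, whence s <= d + t + 1. By induction
   c <= n - 1 + (number of missing edges) + (number of rainbow triangles), and
   the hypothesis says that equality holds. Equality forces G to be complete,
   passes to all induced subgraphs, and puts each vertex in at most one rainbow
   triangle. Unless G is a vertex or a rainbow triangle it has a monochromatic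
   cut: some proper module containing v can be contracted to v, and a cut of the
   smaller graph lifts. *)
Set Implicit Arguments.
Unset Strict Implicit.
Unset Printing Implicit Defensive.

(** * Small sets and systems of representatives *)

Section Sets.

Variable T : finType.
Implicit Types (x y z v : T) (t W S : {set T}).

Lemma set2_inj x y z : [set x; y] = [set x; z] -> y = z.
Proof.
move=> e; have: y \in [set x; z] by rewrite -e !inE eqxx orbT.
have: z \in [set x; y] by rewrite e !inE eqxx orbT.
by rewrite !inE => /orP[/eqP->|/eqP->] // /orP[] /eqP->.
Qed.

Lemma pair_sub_triple x y z (f : {set T}) :
  f \subset [set x; y; z] -> #|f| = 2 ->
  [\/ f = [set x; y], f = [set x; z] | f = [set y; z]].
Proof.
move=> sf /eqP/cards2P[a [b [ab fE]]]; subst f.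
have := subsetP sf a; have := subsetP sf b; rewrite !inE !eqxx orbT /=.
move=> /(_ isT) Hb /(_ isT) Ha.
case/orP: Ha => [/orP[]|] /eqP ?; case/orP: Hb => [/orP[]|] /eqP ?; subst a b;
  rewrite ?eqxx // in ab; rewrite ?[[set y; x]]setUC ?[[set z; _]]setUC;
  first [by constructor 1 | by constructor 2 | by constructor 3].
Qed.

Lemma card2P (f : {set T}) v : #|f| = 2 -> v \in f ->
  exists2 u, u != v & f = [set v; u].
Proof.
move=> /eqP/cards2P[a [b [ab ->]]]; rewrite !inE => /orP[]/eqP ->.
  by exists b; rewrite 1?eq_sym.
by exists a => //; rewrite setUC.
Qed.

Lemma card3P t x y : #|t| = 3 -> x \in t -> y \in t -> x != y ->
  exists2 z, (z != x) && (z != y) & t = [set x; y; z].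
Proof.
move=> t3 xt yt xy.
have /eqP/cards1P[z zE] : #|t :\ x :\ y| = 1.
  have := cardsD1 x t; have := cardsD1 y (t :\ x).
  by rewrite !inE eq_sym xy xt yt t3 /=; lia.
have : z \in t :\ x :\ y by rewrite zE set11.
rewrite !inE => /and3P[zy zx zt].
exists z; first by rewrite zx zy.
apply/setP => w; rewrite !inE.
have := in_set1 w z; rewrite -zE !inE => <-.
by case: eqP => [->|] //=; case: eqP => [->|].
Qed.

(** Serves to pick one edge at a vertex for each colour lost with it. Representatives of different
    colours differ since [g] separates them. *)
Lemma exists_reps (C : eqType) (g : T -> C) W (D : seq C) : uniq D ->
  (forall c, c \in D -> exists2 u, u \in W & g u = c) ->
  exists S, [/\ S \subset W, #|S| = size D, {in S &, injective g}
             & forall u, u \in S -> g u \in D].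
Proof.
elim: D => [_ _|c D IH /= /andP[cD uD] h].
  by exists set0; rewrite sub0set cards0; split=> // u; rewrite inE.
have [|S [SW Sc Sinj SD]] := IH uD; first by move=> d dD; apply: h; rewrite inE dD orbT.
have [u uW gu] := h c (mem_head _ _).
have nS w : w \in S -> g w <> g u by move=> /SD gw e; rewrite -gu -e gw in cD.
have uS : u \notin S by apply/negP => /nS.
exists (u |: S); split.
- by rewrite subUset sub1set uW SW.
- by rewrite cardsU1 uS Sc.
- move=> a b; rewrite !inE => /predU1P[->|aS] /predU1P[->|bS] // e.
  + by case: (nS b bS).
  + by case: (nS a aS).
  + exact: Sinj.
- move=> w; rewrite !inE => /predU1P[->|/SD ->]; last by rewrite orbT.
  by rewrite gu eqxx.
Qed.

End Sets.

(** * Colours, missing edges and rainbow triangles of vertex subsets *)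

Section Deficiency.

Variables (T : finType) (C : eqType) (G : ecgraph T C).
Implicit Types (x y z u v w : T) (f t W S M : {set T}).

Local Notation E := (edges G).
Local Notation col x y := (color G [set x; y]).

Lemma edge_card f : f \in E -> #|f| = 2.
Proof. by move/edgesP/andP => [_ /eqP]. Qed.

Lemma edge_neq x y : [set x; y] \in E -> x != y.
Proof. by move=> /edge_card; rewrite cards2; case: eqP. Qed.

Lemma rainbow_triangleI x y z :
  [set x; y] \in E -> [set x; z] \in E -> [set y; z] \in E ->
  col x y <> col x z -> col x y <> col y z -> col x z <> col y z ->
  rainbow_triangle G [set x; y; z].
Proof.
move=> xy xz yz n1 n2 n3; apply/and3P; split.
- rewrite -setUA cardsU1 cards2 !inE.
  by rewrite (negPf (edge_neq xy)) (negPf (edge_neq xz)) (edge_neq yz).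
- apply/subsetP => f; rewrite inE => /andP[sf /eqP f2].
  by case: (pair_sub_triple sf f2) => ->.
- apply/dinjectiveP => f g; rewrite !inE => /andP[sf /eqP f2] /andP[sg /eqP g2].
  case: (pair_sub_triple sf f2) => ->; case: (pair_sub_triple sg g2) => -> // e;
  first [by case: n1 | by case: n2 | by case: n3].
Qed.

Lemma rainbow_triangle_edge t x y : rainbow_triangle G t ->
  x \in t -> y \in t -> x != y -> [set x; y] \in E.
Proof.
move=> /and3P[_ /subsetP h _] xt yt xy; apply: h.
by rewrite inE cards2 xy subUset !sub1set xt yt.
Qed.

Lemma rainbow_triangle_neq t x y z : rainbow_triangle G t ->
  x \in t -> y \in t -> z \in t -> x != y -> x != z -> y != z ->
  col x y <> col x z.
Proof.
move=> /and3P[_ _ /dinjectiveP inj] xt yt zt xy xz yz e.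
have := inj [set x; y] [set x; z]; rewrite !inE !cards2 xy xz !subUset !sub1set.
by rewrite xt yt zt => /(_ isT isT e)/set2_inj/eqP; apply/negP.
Qed.

(** These parameters depend on a subset of one fixed graph, so the inductions of this section shrink
    [W] and keep [G]. *)
Definition ncol W : nat := ncolors (induced G W).
Definition miss W : nat := #|pairs W :\: E|.
Definition tri W : nat := #|[set t in rainbow_triangles G | t \subset W]|.
Definition mdeg W v : nat := #|[set u in W :\ v | [set v; u] \notin E]|.
Definition tris_at W v : {set {set T}} :=
  [set t in rainbow_triangles G | (t \subset W) && (v \in t)].
Definition tdeg W v : nat := #|tris_at W v|.

Lemma miss_setD1 W v : v \in W -> miss W = miss (W :\ v) + mdeg W v.
Proof.
move=> vW; rewrite /miss /mdeg.
rewrite -(cardsID [set f : {set T} | v \notin f] (pairs W :\: E)); congr (_ + _).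
  apply: eq_card => f; rewrite !inE subsetD1.
  by case: (f \in E); case: (f \subset W); case: (#|f| == 2); case: (v \in f).
rewrite -(card_in_imset (f := fun u => [set v; u])); last by move=> a b _ _; apply: set2_inj.
apply: eq_card => f; apply/idP/imsetP.
  rewrite !inE negbK => /and3P[vf fE /andP[fW /eqP f2]].
  have [u uv fu] := card2P f2 vf.
  exists u => //; rewrite !inE uv -fu fE andbT /=.
  by apply: (subsetP fW); rewrite fu !inE eqxx orbT.
move=> [u]; rewrite !inE => /andP[/andP[uv uW] nE] ->.
by rewrite !inE eqxx /= nE subUset !sub1set vW uW cards2 (eq_sym v) uv.
Qed.

Lemma tri_setD1 W v : tri W = tri (W :\ v) + tdeg W v.
Proof.
rewrite /tri /tdeg -(cardsID [set t : {set T} | v \notin t]); congr (_ + _);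
  apply: eq_card => t; rewrite !inE ?subsetD1 ?negbK.
  by rewrite andbA.
by rewrite andbC andbA.
Qed.

(** The last clause says that the colours represented by [S] are saturated at [v]: within [W] they
    occur only on edges containing [v]. *)
Definition saturated_reps W v (S : {set T}) : Prop :=
  [/\ S \subset W :\ v,
      forall u, u \in S -> [set v; u] \in E,
      {in S &, injective (fun u : T => col v u)}
    & forall u f, u \in S -> f \in E -> f \subset W :\ v -> color G f <> col v u].

(** An edge of [W] with a colour absent from [W :\ v] must contain [v], so each lost colour in [D]
    has a representative among the neighbours of [v]. *)
Lemma ncol_setD1 W v : v \in W ->
  exists2 S : {set T}, ncol W = ncol (W :\ v) + #|S| & saturated_reps W v S.
Proof.
move=> vW.
pose L W := undup [seq color G f | f <- enum (edges (induced G W))].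
pose D := [seq c <- L W | c \notin L (W :\ v)].
have inL V c : c \in L V -> exists2 f, (f \in E) && (f \subset V) & color G f = c.
  rewrite mem_undup => /mapP[f]; rewrite mem_enum inE => fE ->.
  by exists f.
have Lin (V : {set T}) f : f \in E -> f \subset V -> color G f \in L V.
  by move=> fE fV; rewrite mem_undup map_f // mem_enum inE fE.
pose A := [set u in W :\ v | [set v; u] \in E].
have uD : uniq D by rewrite filter_uniq // undup_uniq.
have [|S [SA Sc Sinj SD]] := @exists_reps _ _ (fun u => col v u) A D uD.
  move=> c; rewrite mem_filter => /andP[cn /inL[f /andP[fE fW] fc]].
  have vf : v \in f.
    by apply: contraNT cn => vf; rewrite -fc Lin // subsetD1 fW.
  have [u uv fu] := card2P (edge_card fE) vf.
  exists u; last by rewrite -fu.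
  rewrite !inE uv -fu fE andbT /=.
  by apply: (subsetP fW); rewrite fu !inE eqxx orbT.
exists S.
  rewrite Sc /ncol /ncolors -!/(L _).
  have -> : size (L (W :\ v)) = count (mem (L (W :\ v))) (L W).
    rewrite -size_filter; apply/perm_size/uniq_perm; rewrite ?filter_uniq ?undup_uniq //.
    move=> c; rewrite mem_filter /=; case cL: (c \in L (W :\ v)) => //=.
    have [f /andP[fE]] := inL _ _ cL.
    by rewrite subsetD1 => /andP[fW _] <-; rewrite Lin.
  by rewrite size_filter count_predC.
split=> //.
- by apply: subset_trans SA _; apply/subsetP => u; rewrite inE => /andP[].
- by move=> u /(subsetP SA); rewrite inE => /andP[].
- move=> u f /SD; rewrite mem_filter => /andP[/negP h _] fE fW e.
  by apply: h; rewrite -e Lin.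
Qed.

(** The two edges at [v] differ in colour by injectivity; the third avoids [v], so it carries no
    colour saturated at [v]. *)
Lemma saturated_reps_triangle W v S u w : saturated_reps W v S ->
  u \in S -> w \in S -> [set u; w] \in E -> rainbow_triangle G [set v; u; w].
Proof.
move=> [SW SE Sinj Ssat] uS wS uw; have nuw := edge_neq uw.
have sub : [set u; w] \subset W :\ v.
  by rewrite subUset !sub1set !(subsetP SW).
apply: rainbow_triangleI => //; try exact: SE.
- by move/Sinj => /(_ uS wS)/eqP; apply/negP.
- by move/esym; apply: Ssat.
- by move/esym; apply: Ssat.
Qed.

(* Double counting of the ordered pairs of distinct elements of S: each is
   either a missing edge or spans a rainbow triangle with v. *)
Lemma saturated_reps_card W v S : v \in W -> saturated_reps W v S ->
  #|S| * (#|S| - 1) <= \sum_(u in S) mdeg W u + 2 * tdeg W v.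
Proof.
move=> vW hS; have [SW SE Sinj Ssat] := hS.
(* A rainbow triangle at [v] has only two other vertices, so it is counted at most twice. *)
have tri2 : \sum_(u in S) #|[set t in tris_at W v | u \in t]| <= 2 * tdeg W v.
  have -> : \sum_(u in S) #|[set t in tris_at W v | u \in t]|
          = \sum_(u in S) \sum_(t in tris_at W v | u \in t) 1.
    by apply: eq_bigr => u _; rewrite -sum1_card; apply: eq_bigl => t; rewrite inE.
  rewrite (exchange_big_dep (mem (tris_at W v))) /=; last by move=> u t _ /andP[].
  rewrite /tdeg mulnC -sum_nat_const; apply: leq_sum => t tW.
  rewrite sum1_card; move: (tW); rewrite !inE => /and3P[/and3P[/eqP t3 _ _] _ vt].
  have -> : 2 = #|t :\ v| by have := cardsD1 v t; rewrite vt t3; lia.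
  apply/subset_leq_card/subsetP => u; rewrite unfold_in /= => /and3P[uS _ ut].
  by have := subsetP SW u uS; rewrite !inE ut => /andP[->].
apply: leq_trans (leq_add (leqnn _) tri2).
rewrite -big_split /= -sum_nat_const; apply: leq_sum => u uS.
have -> : #|S| - 1 = #|S :\ u| by have := cardsD1 u S; rewrite uS; lia.
(* For fixed [u], non-neighbours in [S] are counted by [mdeg W u]; neighbours [w] embed into the
   triangles at [v] through [[set v; u; w]]. *)
rewrite -(cardsID [set w | [set u; w] \notin E] (S :\ u)); apply: leq_add.
  apply/subset_leq_card/subsetP => w; rewrite !inE => /andP[/andP[-> wS] ->].
  by have := subsetP SW w wS; rewrite !inE => /andP[_ ->].
have inj : {in S :\ u :\: [set w | [set u; w] \notin E] &,
            injective (fun w => [set v; u; w])}.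
  move=> a b; rewrite !inE => /andP[_ /andP[au aS]] /andP[_ /andP[bu bS]] e.
  have : a \in [set v; u; b] by rewrite -e !inE eqxx orbT.
  have := subsetP SW a aS; rewrite !inE (negPf au) => /andP[/negPf -> _] /=.
  by move/eqP.
rewrite -(card_in_imset inj); apply/subset_leq_card/subsetP => t /imsetP[w].
rewrite !inE negbK => /andP[uw /andP[wu wS]] ->.
rewrite (saturated_reps_triangle hS) // !inE !eqxx orbT /= andbT.
have := subsetP SW u uS; have := subsetP SW w wS; rewrite !inE => /andP[_ ww] /andP[_ uw'].
by rewrite !subUset !sub1set vW ww uw'.
Qed.

(** * The upper bound on the number of colours *)

Lemma ncol1 v : ncol [set v] = 0.
Proof.
rewrite /ncol /ncolors; have -> : edges (induced G [set v]) = set0; last by rewrite enum_set0.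
apply/setP => f; rewrite !inE; apply/negP => /andP[/edge_card f2 /subset_leq_card].
by rewrite f2 cards1.
Qed.

Lemma max_mdeg W : W != set0 ->
  exists2 v, v \in W & forall u, u \in W -> mdeg W u <= mdeg W v.
Proof.
case/set0Pn => v0 v0W.
by case: (@arg_maxnP _ v0 (mem W) (mdeg W) v0W) => v vW h; exists v.
Qed.

Lemma saturated_reps_card_max W v S :
  v \in W -> (forall u, u \in W -> mdeg W u <= mdeg W v) -> saturated_reps W v S ->
  #|S| * (#|S| - 1) <= #|S| * mdeg W v + 2 * tdeg W v.
Proof.
move=> vW vmax hS; apply: leq_trans (saturated_reps_card vW hS) _.
rewrite leq_add2r -sum_nat_const; apply: leq_sum => u uS; apply: vmax.
by case: hS => /subsetP/(_ u uS); rewrite inE => /andP[].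
Qed.

Lemma ncol_ltn W : W != set0 -> ncol W < #|W| + miss W + tri W.
Proof.
have [n] := ubnP #|W|; elim: n W => // n IH W Wn W0.
have [v vW vmax] := max_mdeg W0.
have cW : #|W| = #|W :\ v|.+1 by have := cardsD1 v W; rewrite vW.
have [W'0|W'0] := eqVneq (W :\ v) set0.
  have -> : W = [set v] by rewrite -(setD1K vW) W'0 setU0.
  by rewrite ncol1 cards1.
have [S cS hS] := ncol_setD1 vW.
have hcard := saturated_reps_card_max vW vmax hS.
have := IH (W :\ v) _ W'0; rewrite (miss_setD1 vW) (tri_setD1 W v) cS cW.
move=> /(_ ltac:(lia)); suff : #|S| <= 1 + mdeg W v + tdeg W v by lia.
(* Write s, d, t for [#|S|], [mdeg W v], [tdeg W v]. If s >= d + t + 2, then s(s - 1 - d) >= 2(t +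
   1) > 2t, against [hcard]. *)
by nia.
Qed.

(** * Sets attaining the bound *)

(* By ncol_ltn the inequality is an equality: W has the largest possible number
   of colours. *)
Definition tight W : Prop := W != set0 /\ #|W| + miss W + tri W <= (ncol W).+1.

(** Deleting [v] lowers the bound of [ncol_ltn] by exactly [1 + mdeg W v + tdeg W v]; equality
    survives if no more colours than that are lost. *)
Lemma tight_setD1 W v S : tight W -> v \in W -> W :\ v != set0 ->
  ncol W = ncol (W :\ v) + #|S| -> #|S| <= 1 + mdeg W v + tdeg W v ->
  tight (W :\ v).
Proof.
move=> [W0 hW] vW W'0 cS hS; split=> //; move: hW.
by rewrite (cardsD1 v W) vW (miss_setD1 vW) (tri_setD1 W v) cS; lia.
Qed.

(** Were fewer colours lost, [W :\ v] would violate [ncol_ltn]. *)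
Lemma tight_card_reps W v S : tight W -> v \in W -> W :\ v != set0 ->
  ncol W = ncol (W :\ v) + #|S| -> 1 + mdeg W v + tdeg W v <= #|S|.
Proof.
move=> [W0 hW] vW /ncol_ltn hlt cS; move: hW.
by rewrite (cardsD1 v W) vW (miss_setD1 vW) (tri_setD1 W v) cS; lia.
Qed.

(* If edges were missing, a vertex v with the most missing edges would lie in
   no rainbow triangle, so the ends of its saturated edges would span no edge
   and W :\ v would be a smaller tight set with missing edges. *)
Lemma tight_miss0 W : tight W -> miss W = 0.
Proof.
have [n] := ubnP #|W|; elim: n W => // n IH W Wn tW; have [W0 hW] := tW.
have [v vW vmax] := max_mdeg W0.
have cW : #|W| = #|W :\ v|.+1 by have := cardsD1 v W; rewrite vW.
have [W'0|W'0] := eqVneq (W :\ v) set0.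
  have WE : W = [set v] by rewrite -(setD1K vW) W'0 setU0.
  by move: hW; rewrite WE ncol1 cards1; lia.
have [S cS hS] := ncol_setD1 vW.
have hcard := saturated_reps_card_max vW vmax hS.
have hS1 := tight_card_reps tW vW W'0 cS.
have m0 : miss (W :\ v) = 0.
  by apply: IH; [lia | apply: (tight_setD1 tW vW W'0 cS); nia].
rewrite (miss_setD1 vW) m0 add0n; apply/eqP; rewrite -leqn0 leqNgt; apply/negP => D0.
(* With s, d, t as in the bound, s >= 1 + d + t turns [hcard] into s t <= 2t; t > 0 would give s <=
   2, whereas d > 0 gives s >= 3. *)
have t0 : tdeg W v = 0 by nia.
have /card_gt1P[x [y [xS yS xy]]] : 1 < #|S| by lia.
have [SW _ _ _] := hS.
have /negP[] : [set x; y] \notin E.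
  apply/negP => xyE; have ht := saturated_reps_triangle hS xS yS xyE.
  have /eqP := t0; rewrite cards_eq0 => /eqP/setP/(_ [set v; x; y]).
  rewrite !inE ht !eqxx !subUset !sub1set vW.
  by have := subsetP SW x xS; have := subsetP SW y yS; rewrite !inE => /andP[_ ->] /andP[_ ->].
have /eqP := m0; rewrite cards_eq0 => /eqP/setP/(_ [set x; y]).
rewrite in_setD in_set0 inE cards2 xy subUset !sub1set !(subsetP SW) //= andbT.
by move/negbFE.
Qed.

Lemma tight_edge W x y : tight W -> x \in W -> y \in W -> x != y -> [set x; y] \in E.
Proof.
move=> /tight_miss0/eqP; rewrite cards_eq0 => /eqP/setP/(_ [set x; y]).
rewrite in_setD in_set0 inE cards2 subUset !sub1set => h xW yW xy; move: h.
by rewrite xW yW xy /= andbT => /negbFE.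
Qed.

Lemma tight_mdeg0 W v : tight W -> v \in W -> mdeg W v = 0.
Proof. by move=> /tight_miss0 + vW; rewrite (miss_setD1 vW); lia. Qed.

(** Without missing edges the double count reads s(s - 1) <= 2t for every [v], not only for one of
    largest [mdeg]. This gives s <= t + 1, tightness gives s >= t + 1, and t(t + 1) <= 2t leaves t
    <= 1. *)
Lemma tight_reps W v : tight W -> v \in W -> W :\ v != set0 ->
  exists S, [/\ saturated_reps W v S, #|S| = (tdeg W v).+1, tdeg W v <= 1
              & tight (W :\ v)].
Proof.
move=> tW vW W'0.
have [S cS hS] := ncol_setD1 vW; exists S.
have hS1 := tight_card_reps tW vW W'0 cS.
have := saturated_reps_card vW hS.
rewrite big1 => [|u uS]; last first.
  apply: (tight_mdeg0 tW).
  by case: hS => /subsetP/(_ u uS); rewrite inE => /andP[].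
have m0 := tight_mdeg0 tW vW => hcard.
have le : #|S| <= 1 + mdeg W v + tdeg W v by nia.
split=> //; [lia | nia | exact: tight_setD1 tW vW W'0 cS le].
Qed.

(** The vertices outside [M] are deleted one by one; [tight_reps] permits any order. *)
Lemma tight_subset W M : tight W -> M \subset W -> M != set0 -> tight M.
Proof.
have [n] := ubnP #|W|; elim: n W => // n IH W Wn tW MW M0.
have [->//|nMW] := eqVneq M W.
have : M \proper W by rewrite properEneq nMW.
case/properP => _ [v vW vM].
have MWv : M \subset W :\ v by rewrite subsetD1 MW.
have W'0 : W :\ v != set0.
  by apply: contraNneq M0 => e; rewrite -subset0 -e.
have [S [_ _ _ tW']] := tight_reps tW vW W'0.
by apply: IH tW' MWv M0; have := cardsD1 v W; rewrite vW; lia.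
Qed.

(** * Monochromatic cuts of tight sets *)

Definition mono_partition W : Prop :=
  exists V1 V2 : {set T}, exists a : C,
    [/\ V1 != set0, V2 != set0, [disjoint V1 & V2], V1 :|: V2 = W
      & forall x y, x \in V1 -> y \in V2 -> col x y = a].

Lemma mono_partition_sym (V1 V2 : {set T}) a :
  V1 != set0 -> V2 != set0 -> [disjoint V1 & V2] ->
  (forall x y, x \in V1 -> y \in V2 -> col x y = a) ->
  [/\ V2 != set0, V1 != set0, [disjoint V2 & V1], V2 :|: V1 = V1 :|: V2
      & forall x y, x \in V2 -> y \in V1 -> col x y = a].
Proof.
move=> V10 V20 dV h; split=> //; rewrite 1?disjoint_sym 1?setUC //.
by move=> x y xV yV; rewrite setUC h.
Qed.

(* Vertices outside the module M do not distinguish its elements, so M may be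
   contracted to v. *)
Lemma mono_partition_module W M v : M \subset W -> v \in M ->
  (forall x y, x \in M -> y \in W :\: M -> col x y = col v y) ->
  mono_partition (v |: W :\: M) -> mono_partition W.
Proof.
move=> MW vM hM [V1 [V2 [a [V10 V20 dV VE hV]]]].
wlog vV1 : V1 V2 V10 V20 dV VE hV / v \in V1.
  move=> wl; have : v \in V1 :|: V2 by rewrite VE !inE eqxx.
  rewrite inE => /orP[vV|vV]; first exact: (wl V1 V2).
  have [p1 p2 p3 p4 p5] := mono_partition_sym V10 V20 dV hV.
  by apply: (wl V2 V1) => //; rewrite p4.
have vV2 : v \notin V2 by rewrite (disjointFr dV).
have V2W : V2 \subset W :\: M.
  apply/subsetP => y yV; have : y \in v |: W :\: M by rewrite -VE inE yV orbT.
  rewrite in_setU1 => /predU1P[yv|//]; by rewrite -yv yV in vV2.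
(* Undoing the contraction puts all of [M] on the side of [v]. *)
exists (V1 :|: M), V2, a; split=> //.
- by apply/set0Pn; exists v; rewrite inE vM orbT.
- rewrite disjoints_subset subUset -!disjoints_subset dV /=.
  rewrite disjoint_sym disjoints_subset; apply: subset_trans V2W _.
  by rewrite setDE subsetIr.
- rewrite setUAC VE; apply/setP => x; rewrite !inE.
  have := subsetP MW x; case: (x \in M); rewrite ?andbF ?orbT ?orbF /=; first by move=> ->.
  by case: eqP => // -> _; rewrite (subsetP MW).
- move=> x y; rewrite inE => /orP[xV|xM] yV; first exact: hV.
  by rewrite (hM x y xM (subsetP V2W y yV)) hV.
Qed.

(* The contracted module is the set of neighbours of v along its saturated
   colour together with v when tdeg W v = 0, and the rainbow triangle at v when
   tdeg W v = 1. *)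
Lemma tight_mono_partition W : tight W -> 1 < #|W| -> ~~ rainbow_triangle G W ->
  mono_partition W.
Proof.
have [n] := ubnP #|W|; elim: n W => // n IH W Wn tW W1 nW.
have [W0 _] := tW; have /set0Pn[v vW] := W0.
have cW : #|W| = #|W :\ v|.+1 by have := cardsD1 v W; rewrite vW.
have W'0 : W :\ v != set0 by rewrite -card_gt0; lia.
(* Induction applies to the contracted set [v |: W :\: M]. It is smaller as [M] has a second
   element, and it is not a rainbow triangle: one at [v] would contain [M], while it meets [M] only
   in [v]. *)
have step M : M \subset W -> v \in M -> 1 < #|M| -> W :\: M != set0 ->
  (forall x y, x \in M -> y \in W :\: M -> col x y = col v y) ->
  (forall t, t \in tris_at W v -> M \subset t) -> mono_partition W.
  move=> MW vM M1 WM0 hM ht; apply: (mono_partition_module MW vM hM).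
  have cvWM : #|v |: W :\: M| = #|W :\: M|.+1 by rewrite cardsU1 !inE vM.
  have cWM : #|W| = #|M| + #|W :\: M|.
    by rewrite -(cardsID M W) (setIidPr MW).
  have sub : v |: W :\: M \subset W by rewrite subUset sub1set vW subsetDl.
  have nM : ~~ (M \subset v |: W :\: M).
    apply/negP => h; have : M \subset [set v].
      apply/subsetP => x xM; have := subsetP h x xM.
      by rewrite !inE xM orbF.
    by move/subset_leq_card; rewrite cards1; lia.
  apply: IH; first by lia.
  - by apply: (tight_subset tW sub); apply/set0Pn; exists v; rewrite !inE eqxx.
  - by rewrite cvWM ltnS card_gt0.
  - apply: contra nM => rt; apply: ht; rewrite !inE rt sub /=.
    by rewrite eqxx.
have [S [hS cS t1 tW']] := tight_reps tW vW W'0.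
have [SW SE Sinj Ssat] := hS.
have [t0|t0] := eqVneq (tdeg W v) 0.
  have /card_gt0P[u uS] : 0 < #|S| by rewrite cS.
  pose a := col v u.
  pose M := v |: [set x in W :\ v | col v x == a].
  (* The colour [a] is saturated, so the edge xy avoids it; if xy and vy also differed in colour,
     [v] would lie in a rainbow triangle. *)
  have notri x y : x \in W :\ v -> y \in W :\ v -> x != y ->
      col v x = a -> col v y <> a -> col x y = col v y.
    move=> xW yW xy xa ya; apply/eqP; apply: contraT => /eqP ne.
    have xyE := tight_edge tW' xW yW xy.
    move: (xW) (yW); rewrite !inE => /andP[xv xW0] /andP[yv yW0].
    have rt : rainbow_triangle G [set v; x; y].
      apply: rainbow_triangleI => //; try by apply: (tight_edge tW); rewrite 1?eq_sym.
      - by rewrite xa => /esym.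
      - rewrite xa => /esym; apply: Ssat => //.
        by rewrite subUset !sub1set xW yW.
      - by move/esym.
    have /eqP := t0; rewrite cards_eq0 => /eqP/setP/(_ [set v; x; y]).
    by rewrite !inE rt !eqxx !subUset !sub1set vW xW0 yW0.
  have uM : u \in M by rewrite in_setU1 inE (subsetP SW) // -/a eqxx orbT.
  have MW : M \subset W.
    rewrite subUset sub1set vW; apply/subsetP => x; rewrite !inE.
    by case/andP => /andP[].
  have uv : u != v by have := subsetP SW u uS; rewrite !inE => /andP[].
  (* If [M] is all of [W], every edge at [v] has colour [a] and [v] alone is one side of a cut. *)
  have [WM0|WM0] := eqVneq (W :\: M) set0.
    have WM : W = M.
      by apply/eqP; rewrite eqEsubset MW -setD_eq0 WM0 eqxx.
    exists [set v], (W :\ v), a; split=> //.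
    + by apply/set0Pn; exists v; rewrite inE.
    + by rewrite disjoints1 !inE eqxx.
    + by rewrite setD1K.
    + move=> x y /set1P->; rewrite {1}WM !inE => /andP[/negPf ->] /=.
      by case/andP => _ /eqP.
  apply: (step M) => //.
  - by rewrite !inE eqxx.
  - apply/card_gt1P; exists v, u; split=> //; first by rewrite !inE eqxx.
    by rewrite eq_sym.
  - move=> x y; rewrite in_setU1 => /predU1P[->//|]; rewrite in_set => /andP[xW /eqP xa].
    rewrite !inE negb_or => /andP[/andP[yv yM] yW].
    have yW' : y \in W :\ v by rewrite !inE yv.
    have ya : col v y <> a by move/eqP=> e; rewrite yv yW e in yM.
    by apply: notri => //; apply/eqP => e; rewrite -e xa in ya.
  - move=> t tt; have /eqP := t0; rewrite cards_eq0 => /eqP/setP/(_ t).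
    by rewrite tt inE.
have td1 : tdeg W v = 1 by lia.
have /card_gt1P[x [y [xS yS xy]]] : 1 < #|S| by lia.
have xW := subsetP SW x xS; have yW := subsetP SW y yS.
have xyE := tight_edge tW' xW yW xy.
have rt := saturated_reps_triangle hS xS yS xyE.
move: (xW) (yW); rewrite !inE => /andP[xv xW0] /andP[yv yW0].
pose M := [set v; x; y].
have MW : M \subset W by rewrite !subUset !sub1set vW xW0 yW0.
have vM : v \in M by rewrite !inE eqxx.
have xM : x \in M by rewrite !inE eqxx orbT.
have yM : y \in M by rewrite !inE eqxx orbT.
have uniqM t : t \in tris_at W v -> t = M.
  have /eqP/cards1P[t' t'E] := td1.
  have : M \in tris_at W v by rewrite inE inE rt MW vM.
  by rewrite t'E => /set1P -> /set1P.
have uniqR p q : p \in W -> q \in W -> rainbow_triangle G [set v; p; q] -> p \in M.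
  move=> pW qW rt'; have <- : [set v; p; q] = M; last by rewrite !inE eqxx orbT.
  by apply: uniqM; rewrite !inE rt' !subUset !sub1set vW pW qW eqxx.
have modM p q w : p \in S -> q \in S -> p != q -> w \in W :\: M -> col p w = col v w.
  move=> pS qS pq; rewrite in_setD => /andP[wM wW].
  have pW := subsetP SW p pS; have qW := subsetP SW q qS.
  have wv : w != v by apply: contraNneq wM => ->.
  have wW' : w \in W :\ v by rewrite in_setD1 wv.
  move: (pW) (qW); rewrite !inE => /andP[pv pW0] /andP[qv qW0].
  have SM r : r \in S -> r \in M.
    move=> rS; have [->//|rx] := eqVneq r x.
    have rW := subsetP SW r rS.
    have rt' := saturated_reps_triangle hS rS xS (tight_edge tW' rW xW rx).
    by apply: uniqR rt' => //; move: rW; rewrite inE => /andP[].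
  have wp : w != p by apply: contraNneq wM => ->; exact: SM.
  have wq : w != q by apply: contraNneq wM => ->; exact: SM.
  have in' r s : r \in W :\ v -> s \in W :\ v -> [set r; s] \subset W :\ v.
    by move=> rW sW; rewrite subUset !sub1set rW sW.
  have wpE := tight_edge tW' wW' pW wp; have wqE := tight_edge tW' wW' qW wq.
  have vE r : r \in W -> r != v -> [set v; r] \in E.
    by move=> rW rv; apply: tight_edge tW _ _ _ => //; rewrite eq_sym.
  (* Otherwise vw and vq differ in colour, and wq avoids both colours since they are saturated; the
     rainbow triangle on v, w, q would force [w] into [M]. *)
  have vwp : col v w <> col v p.
    move=> e; move/negP: wM; apply; apply: (uniqR w q) => //.
    apply: rainbow_triangleI => //; try exact: vE.
    - by rewrite e => /Sinj => /(_ pS qS)/eqP; apply/negP.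
    - by rewrite e => /esym; apply: Ssat => //; apply: in'.
    - by move/esym; apply: Ssat => //; apply: in'.
  (* The colour of vp is not that of vw, nor that of wp by saturation, so different colours on wp
     and vw would make v, w, p rainbow. *)
  apply/eqP; apply: contraT => /eqP ne.
  move/negP: wM; case; apply: (uniqR w p) => //.
  apply: rainbow_triangleI => //; try exact: vE.
  - by rewrite [[set w; p]]setUC => /esym.
  - by move/esym; apply: Ssat => //; apply: in'.
apply: (step M) => //.
- by apply/card_gt1P; exists v, x; rewrite vM xM eq_sym.
- rewrite setD_eq0; apply: contra nW => WM.
  by have -> : W = M by apply/eqP; rewrite eqEsubset WM.
- move=> p w; rewrite !inE -orbA => /or3P[]/eqP -> // wM.
  + by apply: (modM x y) => //; rewrite !inE.
  + by apply: (modM y x) => //; rewrite ?inE // eq_sym.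
- by move=> t /uniqM ->.
Qed.

(** A triangle meeting both sides has two edges across the cut, both of colour [a], so it is not
    rainbow. *)
Lemma tri_mono (V1 V2 : {set T}) a : [disjoint V1 & V2] ->
  (forall x y, x \in V1 -> y \in V2 -> col x y = a) ->
  tri V1 + tri V2 = tri (V1 :|: V2).
Proof.
move=> dV hV.
rewrite /tri -(cardsID [set t : {set T} | t \subset V1]
                      [set t in rainbow_triangles G | t \subset V1 :|: V2]).
congr (_ + _); apply: eq_card => t; rewrite !inE.
  case rt: (rainbow_triangle G t) => //=; case tV: (t \subset V1); rewrite ?andbF ?andbT //.
  by rewrite (subset_trans tV) // subsetUl.
case rt: (rainbow_triangle G t); rewrite ?andbF //=.
have /and3P[/eqP t3 _ _] := rt.
apply/idP/andP => [tV|[/subsetPn[x xt xV1] tV]].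
  split; last by rewrite (subset_trans tV) // subsetUr.
  have /card_gt0P[x xt] : 0 < #|t| by rewrite t3.
  by apply/subsetPn; exists x => //; rewrite (disjointFl dV) // (subsetP tV).
have inV z : z \in t -> (z \in V1) || (z \in V2) by move/(subsetP tV); rewrite inE.
apply/subsetP => y yt; apply: contraT => yV2.
have xV2 : x \in V2 by have := inV x xt; rewrite (negPf xV1).
have yV1 : y \in V1 by have := inV y yt; rewrite (negPf yV2) orbF.
have yx : y != x by apply: contraNneq xV1 => <-.
have [z /andP[zy zx] tE] := card3P t3 yt xt yx.
have zt : z \in t by rewrite tE !inE eqxx !orbT.
have [xy xz yz] : [/\ x != y, x != z & y != z] by split; rewrite eq_sym.
case/orP: (inV z zt) => zV.
  have [] := rainbow_triangle_neq rt xt yt zt xy xz yz.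
  by rewrite [[set x; y]]setUC [[set x; z]]setUC !hV.
have [] := rainbow_triangle_neq rt yt xt zt yx yz xz.
by rewrite !hV.
Qed.

End Deficiency.

(** * From tight sets to the recursive classes *)

Section Main.

Variables (T : finType) (C : eqType).
Implicit Types (G : ecgraph T C) (V W : {set T}).

Lemma card_pairs V : #|pairs V| = 'C(#|V|, 2).
Proof. exact: cards_draws. Qed.

Lemma edges_sub_pairs G : edges G \subset pairs (vset G).
Proof. by apply/subsetP => f /edgesP; rewrite inE. Qed.

Lemma rainbow_triangle_sub G t : rainbow_triangle G t -> t \subset vset G.
Proof.
move=> rt; have /and3P[/eqP t3 _ _] := rt; apply/subsetP => x xt.
have /card_gt0P[y] : 0 < #|t :\ x| by have := cardsD1 x t; rewrite xt t3; lia.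
rewrite !inE => /andP[yx yt].
have := rainbow_triangle_edge rt yt xt yx.
by move/edgesP/andP => [/subsetP h _]; apply: h; rewrite !inE eqxx orbT.
Qed.

Lemma ncol_vset G : ncol G (vset G) = ncolors G.
Proof.
rewrite /ncol /ncolors /=; suff -> : [set f in edges G | f \subset vset G] = edges G by [].
by apply/setP => f; rewrite inE andb_idr // => /edgesP/andP[].
Qed.

Lemma tri_vset G : tri G (vset G) = #|rainbow_triangles G|.
Proof.
apply: eq_card => t; rewrite inE andb_idr // inE; exact: rainbow_triangle_sub.
Qed.

Lemma miss_vset G : miss G (vset G) + nedges G = 'C(gorder G, 2).
Proof.
rewrite /miss /nedges -card_pairs -(cardsID (edges G) (pairs _)).
by rewrite (setIidPr (edges_sub_pairs G)) addnC.
Qed.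

Lemma rainbow_triangle_induced G V t :
  rainbow_triangle (induced G V) t = rainbow_triangle G t && (t \subset V).
Proof.
rewrite /rainbow_triangle /rainbow /=.
case t3: (#|t| == 3) => //=; case: (dinjectiveb _ _); rewrite ?andbF //= !andbT.
apply/idP/andP => [/subsetP h|[/subsetP h tV]]; last first.
  apply/subsetP => f fp; rewrite inE h //=.
  by move: fp; rewrite inE => /andP[ft _]; apply: subset_trans tV.
split; first by apply/subsetP => f /h; rewrite inE => /andP[].
apply/subsetP => x xt.
have /card_gt0P[y] : 0 < #|t :\ x|.
  by have := cardsD1 x t; rewrite xt (eqP t3); lia.
rewrite !inE => /andP[yx yt].
have /h : [set x; y] \in pairs t.
  by rewrite inE cards2 (eq_sym x) yx subUset !sub1set xt yt.
by rewrite inE subUset !sub1set => /and3P[].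
Qed.

(** The classes recurse on graphs while heredity is proved for subsets of one graph; the three
    counts agree under this change of view. *)
Lemma tight_induced G V : V \subset vset G -> tight G V ->
  tight (induced G V) (vset (induced G V)).
Proof.
rewrite /= => VG [V0 hV]; rewrite (setIidPr VG); split=> //; move: hV.
have -> : miss (induced G V) V = miss G V.
  apply: eq_card => f; rewrite !inE.
  by case: (f \subset V); rewrite ?andbT ?andbF.
have -> : tri (induced G V) V = tri G V.
  apply: eq_card => t; rewrite !inE rainbow_triangle_induced.
  by rewrite -andbA andbb.
suff -> : ncol (induced G V) V = ncol G V by [].
rewrite /ncol /ncolors /=.
suff -> : [set f in [set f in edges G | f \subset V] | f \subset V] =
          [set f in edges G | f \subset V] by [].
by apply/setP => f; rewrite !inE -andbA andbb.
Qed.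

(** Tightness yields completeness and the exact colour count. A monochromatic cut splits [G] into
    parts that are tight by heredity, and [tri_mono] adds up their indices. *)
Lemma tight_Gclass G : tight G (vset G) -> Gclass (tri G (vset G)) G.
Proof.
have [n] := ubnP (gorder G); elim: n G => // n IH G Gn tG; have [G0 hG] := tG.
have Gpos : 0 < gorder G by rewrite card_gt0.
have common : Gclass_common (tri G (vset G)) G.
  split.
  - by move=> x y xG yG xy; apply: (tight_edge tG).
  - by rewrite tri_vset.
  - have := ncol_ltn G G0; move: hG; rewrite (tight_miss0 tG) ncol_vset /gorder in Gpos *.
    by lia.
have [G1|G1] := eqVneq (gorder G) 1; first exact: Gclass_vertex.
have [rG|rG] := boolP (rainbow_triangle G (vset G)); first exact: Gclass_triangle.
have [|V1 [V2 [a [V10 V20 dV VE hV]]]] := tight_mono_partition tG _ rG.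
  by rewrite -/(gorder G); lia.
have cV : gorder G = #|V1| + #|V2|.
  by rewrite /gorder -VE cardsU disjoint_setI0 // cards0 subn0.
have V1G : V1 \subset vset G by rewrite -VE subsetUl.
have V2G : V2 \subset vset G by rewrite -VE subsetUr.
have c1 : 0 < #|V1| by rewrite card_gt0.
have c2 : 0 < #|V2| by rewrite card_gt0.
have part V : V \subset vset G -> V != set0 -> #|V| < gorder G ->
    Gclass (tri G V) (induced G V).
  move=> VG V0 Vlt; have tV := tight_induced VG (tight_subset tG VG V0).
  have -> : tri G V = tri (induced G V) (vset (induced G V)).
    rewrite /= (setIidPr VG); apply: eq_card => t.
    by rewrite !inE rainbow_triangle_induced -andbA andbb.
  by apply: IH => //; rewrite /gorder /= (setIidPr VG); lia.
apply: (@Gclass_split _ _ _ G V1 V2 (tri G V1) (tri G V2)) => //.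
- by exists a => x y xV yV _; apply: hV.
- by apply: part => //; lia.
- by apply: part => //; lia.
- by rewrite (tri_mono dV hV) VE.
Qed.

End Main.

Theorem theorem3 (T : finType) (C : eqType) (G : ecgraph T C) (k : nat)
  (hG : 0 < gorder G)
  (hn : 3 * k <= gorder G)
  (hmc : 'C((gorder G).+1, 2) + k - 1 <= nedges G + ncolors G)
  (hk : #|rainbow_triangles G| = k) :
  Gclass k G.
Proof.
rewrite -hk -tri_vset; apply: tight_Gclass; split; first by rewrite -card_gt0.
rewrite ncol_vset tri_vset hk -/(gorder G).
(* As 'C(n + 1, 2) = 'C(n, 2) + n and the edges together with the missing pairs number 'C(n, 2), the
   hypothesis becomes n + miss + k <= c + 1, which is tightness. *)
by move: hmc; rewrite binS bin1 -(miss_vset G); lia.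
Qed.
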